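(* Let $S$ be an inverse semigroup, and $s,t\in S$. (1) If $s\sim_s^1 t$, then $s^{-1}\sim_s^1 t^{-1}$. (2) If $s\sim_s t$, then $s^{-1}\sim_s t^{-1}$. (3) If $s\leq t$, then for all $t'\in S$ such that $t\sim_s^1 t'$, there exists $s'\in S$ such that $s'\leq t'$ and $s\sim_s^1 s'$. (4) If $s\leq t$, then for all $t'\in S$ such that $t\sim_s t'$, there exists $s'\in S$ such that $s'\leq t'$ and $s\sim_s s'$.
   Context: An inverse semigroup is a semigroup $S$ in which for each $s\in S$ there is a unique $s^{-1}\in S$ with $s=ss^{-1}s$ and $s^{-1}=s^{-1}ss^{-1}$. The natural partial order on $S$ is: $s\leq t$ if $s=te$ for some idempotent $e\in S$ (equivalently, $s=et$ for some idempotent $e\in S$). $S^1$ denotes the monoid obtained by adjoining an identity element $1$ to $S$; if $S$ is already a monoid, $S^1=S$. For $s,t\in S$, $s\sim_s^1 t$ means there exist a positive integer $n$, elements $p_1,\dots,p_n\in S^1$, and a permutation $f$ of $\{1,\dots,n\}$ with $s=p_1\cdots p_n$ and $t=p_{f(1)}\cdots p_{f(n)}$; $\sim_s$ is the transitive closure of $\sim_s^1$. *)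

(* Defs.v *)
From HB Require Import structures.
From Stdlib Require Import Relation_Operators.
From mathcomp Require Import all_boot all_fingroup.
From mathcomp Require Import boolp.

Set Implicit Arguments.
Unset Strict Implicit.
Unset Printing Implicit Defensive.

Local Open Scope group_scope.

Definition is_inverse (S : magmaType) (s s' : S) : Prop :=
  s = s * s' * s /\ s' = s' * s * s'.

(* The library's [x^-1] requires a distinguished unit, hence the separate
   operation [sinv]. *)
HB.mixin Record Semigroup_isInverse S of Semigroup S := {
  sinv : S -> S;
  sinvP : forall s : S, unique (is_inverse s) (sinv s)
}.

#[short(type="inverseSemigroupType")]
HB.structure Definition InverseSemigroup :=
  {S of Semigroup S & Semigroup_isInverse S}.

Definition idempotent_elt (S : magmaType) (e : S) : Prop := e * e = e.

Definition natural_le (S : magmaType) (s t : S) : Prop :=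
  exists2 e : S, idempotent_elt e & s = t * e.

Definition has_unit (S : magmaType) : Prop :=
  exists e : S, left_id e mul /\ right_id e mul.

(* The monoid S^1: an element [None] is adjoined to S as an identity, but only
   when S has no identity already; otherwise the elements are the [Some a] with
   a in S, and the identity is that of S. *)
Section Adjoin1.
Variable S : semigroupType.

Definition in_adjoin1 (x : option S) : bool := x || ~~ `[< has_unit S >].

Record adjoin1 : Type :=
  Adjoin1 { adjoin1_val : option S; _ : in_adjoin1 adjoin1_val }.

HB.instance Definition _ := [isSub for adjoin1_val].
HB.instance Definition _ := [Choice of adjoin1 by <:].

Definition adjoin1_inj (x : S) : adjoin1 :=
  @Adjoin1 (Some x) (erefl true).

Definition omul (x y : option S) : option S :=
  match x, y with
  | Some a, Some b => Some (a * b)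
  | Some a, None => Some a
  | None, _ => y
  end.

Fact omul_in_adjoin1 (x y : adjoin1) : in_adjoin1 (omul (val x) (val y)).
Proof. by case: x y => [[a|] ax] [[b|] bx]. Qed.

Definition adjoin1_mul (x y : adjoin1) : adjoin1 :=
  Adjoin1 (omul_in_adjoin1 x y).

Fact adjoin1_mulA : associative adjoin1_mul.
Proof.
move=> x y z; apply: val_inj => /=.
by case: (val x) (val y) (val z) => [a|] [b|] [c|] //=; rewrite mulgA.
Qed.

Definition adjoin1_one : adjoin1 :=
  match pselect (has_unit S) with
  | left h => adjoin1_inj (projT1 (cid h))
  | right h => @Adjoin1 None (introN (asboolP _) h)
  end.

Fact adjoin1_mul1g : left_id adjoin1_one adjoin1_mul.
Proof.
rewrite /adjoin1_one; case: pselect => [h|h] [x hx]; apply: val_inj => //=.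
case: cid => e /= [e1 _]; case: x hx => [a|] /=; first by rewrite e1.
by rewrite /in_adjoin1 /=; move/asboolP.
Qed.

Fact adjoin1_mulg1 : right_id adjoin1_one adjoin1_mul.
Proof.
rewrite /adjoin1_one; case: pselect => [h|h] [x hx]; apply: val_inj => /=.
  case: cid => e /= [_ e1]; case: x hx => [a|] /=; first by rewrite e1.
  by rewrite /in_adjoin1 /=; move/asboolP.
by case: x hx.
Qed.

HB.instance Definition _ :=
  isMonoid.Build adjoin1 adjoin1_mulA adjoin1_mul1g adjoin1_mulg1.

Fact adjoin1_injM : {morph adjoin1_inj : x y / x * y}.
Proof. by move=> x y; apply: val_inj. Qed.

HB.instance Definition _ :=
  isMultiplicative.Build S adjoin1 adjoin1_inj adjoin1_injM.

Lemma adjoin1_inj_injective : injective adjoin1_inj.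
Proof. by move=> x y []. Qed.

Lemma adjoin1_inj_surj : has_unit S -> forall y, exists x, y = adjoin1_inj x.
Proof.
move=> h [[a|] ax]; first by exists a; apply: val_inj.
by exfalso; move: (ax); rewrite /in_adjoin1 /= => /asboolP.
Qed.

Lemma adjoin1_surj (y : adjoin1) :
  y = adjoin1_one \/ exists x, y = adjoin1_inj x.
Proof.
have [h|h] := pselect (has_unit S); first by right; apply: adjoin1_inj_surj.
case: y => [[a|] ax]; first by right; exists a; apply: val_inj.
by left; rewrite /adjoin1_one; case: pselect => // h'; apply: val_inj.
Qed.

End Adjoin1.

Definition sim1 (S : semigroupType) (s t : S) : Prop :=
  exists (n : nat) (p : 'I_n -> adjoin1 S) (f : {perm 'I_n}),
    [/\ (0 < n)%N,
        adjoin1_inj s = \prod_(i < n) p i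
      & adjoin1_inj t = \prod_(i < n) p (f i)].

Definition sim (S : semigroupType) : S -> S -> Prop :=
  clos_trans S (@sim1 S).

(* Main.v *)
Require Import Defs.
From HB Require Import structures.
From Stdlib Require Import Relation_Operators.
From mathcomp Require Import all_boot all_fingroup.

Set Implicit Arguments.
Unset Strict Implicit.
Unset Printing Implicit Defensive.

Local Open Scope group_scope.

(** Both one-step claims are computed in S^1, which is again an inverse
semigroup.

Inversion reverses products, so inverting s = p_1 ... p_n and
t = p_f(1) ... p_f(n) writes both inverses as products of the p_i^-1, and one
passes between these by the permutation f conjugated by the reversal of
{1, ..., n} ([sim1_sinv]).

If s = t e with e idempotent, the factor e can be absorbed into the last factor
of t = p_1 ... p_n. Each new factor lies below the old one, and the natural
order is compatible with products; so rearranging the new factors in the order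
that gives t' yields an element below t' ([sim1_natural_le]). Such an element
lies in S, because S is a down-set of S^1 ([natural_le_adjoin1_inj]).

Both facts about inverse semigroups used here, (a b)^-1 = b^-1 a^-1 and the
compatibility of the order with products, come from the commutation of
idempotents ([idempotent_comm]). The claims on the transitive closure follow by
induction on the chain of steps. *)

Section InverseSemigroupTheory.
Variable S : inverseSemigroupType.
Implicit Types a b e f s t : S.

Lemma is_inverse_sinv s : is_inverse s (sinv s).
Proof. by case: (sinvP s). Qed.

Lemma sinv_unique s t : is_inverse s t -> sinv s = t.
Proof. by case: (sinvP s) => _; apply. Qed.

Lemma mulgVg s : s * sinv s * s = s.
Proof. by case: (is_inverse_sinv s) => /esym. Qed.

Lemma mulVgV s : sinv s * s * sinv s = sinv s.
Proof. by case: (is_inverse_sinv s) => _ /esym. Qed.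

Lemma sinv_idempotent e : idempotent_elt e -> sinv e = e.
Proof. by move=> ee; apply: sinv_unique; split; rewrite !ee. Qed.

Lemma idempotent_mulgV s : idempotent_elt (s * sinv s).
Proof. by rewrite /idempotent_elt mulgA mulgVg. Qed.

Lemma idempotent_mulVg s : idempotent_elt (sinv s * s).
Proof. by rewrite /idempotent_elt mulgA mulVgV. Qed.

(** With x the inverse of e f, the element f x e is idempotent and is also an
inverse of e f. By uniqueness x = f x e, so x is its own inverse; but e f is an
inverse of x too, hence e f = x. *)
Lemma idempotentM e f :
  idempotent_elt e -> idempotent_elt f -> idempotent_elt (e * f).
Proof.
move=> ee ff; set x := sinv (e * f).
have efxef : e * f * x * e * f = e * f by rewrite -[RHS]mulgVg !mulgA.
have xefx : x * e * f * x = x by rewrite -[RHS]mulVgV !mulgA.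
have fxe_idem : idempotent_elt (f * x * e).
  by rewrite /idempotent_elt -!mulgA; congr (f * _); rewrite !mulgA xefx.
have fxe_inv : is_inverse (e * f) (f * x * e).
  split; rewrite !mulgA -[_ * f * f]mulgA ff -[_ * e * e]mulgA ee ?efxef //.
  by rewrite -[LHS]fxe_idem !mulgA.
have xE : x = f * x * e by apply: sinv_unique.
have <- : x = e * f; last by rewrite xE.
rewrite -[LHS]sinv_idempotent; last by rewrite xE.
by apply: sinv_unique; split; rewrite !mulgA ?xefx ?efxef.
Qed.

(** The idempotents e f and f e are inverse to one another, and e f is its own
inverse; inverses being unique, they coincide. *)
Lemma idempotent_comm e f :
  idempotent_elt e -> idempotent_elt f -> e * f = f * e.
Proof.
move=> ee ff; have ef := idempotentM ee ff; have fe := idempotentM ff ee.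
rewrite -[LHS]sinv_idempotent //; apply: sinv_unique.
have absorb a b : idempotent_elt a -> idempotent_elt b ->
    idempotent_elt (a * b) -> a * b = a * b * (b * a) * (a * b).
  move=> aa bb ab; rewrite !mulgA -[a * b * b]mulgA bb.
  by rewrite -[a * b * a * a]mulgA aa -[LHS]ab !mulgA.
by split; apply: absorb.
Qed.

Lemma sinvM s t : sinv (s * t) = sinv t * sinv s.
Proof.
have comm := idempotent_comm (idempotent_mulgV t) (idempotent_mulVg s).
apply: sinv_unique; split.
  transitivity (s * (t * sinv t * (sinv s * s)) * t); last by rewrite !mulgA.
  by rewrite comm !mulgA mulgVg -!mulgA [t * (_ * _)]mulgA mulgVg.
transitivity (sinv t * (sinv s * s * (t * sinv t)) * sinv s);
  last by rewrite !mulgA.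
by rewrite -comm !mulgA mulVgV -!mulgA [sinv s * (_ * _)]mulgA mulVgV.
Qed.

Lemma natural_le_refl s : natural_le s s.
Proof.
by exists (sinv s * s); [exact: idempotent_mulVg|rewrite mulgA mulgVg].
Qed.

(** An idempotent on the left of b can be moved to its right: e b = b e' where
e' = b^-1 e b. *)
Lemma idempotent_mull_le e b : idempotent_elt e -> natural_le (e * b) b.
Proof.
move=> ee; have comm := idempotent_comm (idempotent_mulgV b) ee.
have ebE : b * (sinv b * e * b) = e * b.
  by rewrite !mulgA comm -!mulgA [b * (_ * _)]mulgA mulgVg.
exists (sinv b * e * b) => //.
by rewrite /idempotent_elt -[LHS]mulgA ebE -!mulgA [e * (e * _)]mulgA ee.
Qed.

(** In a s = b e t f, the idempotent e is moved past t, where it meets f; the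
product of the two idempotents on the right is idempotent. *)
Lemma natural_leM a b s t :
  natural_le a b -> natural_le s t -> natural_le (a * s) (b * t).
Proof.
move=> [e ee ->] [f ff ->]; have [g gg etE] := idempotent_mull_le t ee.
exists (g * f); first exact: idempotentM.
by rewrite mulgA -[b * e * t]mulgA etE !mulgA.
Qed.

End InverseSemigroupTheory.

Section Adjoin1Inverse.
Variable S : inverseSemigroupType.
Implicit Types (s t : S) (x y : adjoin1 S).

Fact omap_sinv_in_adjoin1 x : in_adjoin1 (omap (@sinv S) (val x)).
Proof. by case: x => [[a|] ax]. Qed.

Definition adjoin1_inv x : adjoin1 S := Adjoin1 (omap_sinv_in_adjoin1 x).

(** An adjoined identity is the only element having it as an inverse, since a
product with a factor in S lies in S. *)
Fact adjoin1_invP x : unique (is_inverse x) (adjoin1_inv x).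
Proof.
split.
  by split; apply: val_inj; case: x => [[a|] ax] //=; rewrite ?mulgVg ?mulVgV.
case: x => [[a|] ax] [[b|] bx] [/(congr1 val)/= aE /(congr1 val)/= bE] //;
  apply: val_inj => //=.
by move: aE bE => [aE] [bE]; rewrite (@sinv_unique _ a b).
Qed.

HB.instance Definition _ :=
  Semigroup_isInverse.Build (adjoin1 S) adjoin1_invP.

Lemma adjoin1_injV s : adjoin1_inj (sinv s) = sinv (adjoin1_inj s).
Proof. exact: val_inj. Qed.

(** S is an ideal of S^1, hence a down-set. This brings an element constructed
in S^1 back to S, together with its order relation. *)
Lemma natural_le_adjoin1_inj x t :
  natural_le x (adjoin1_inj t) ->
  exists2 s, x = adjoin1_inj s & natural_le s t.
Proof.
move=> [e ee ->]; case: (adjoin1_surj e) => [->|[f fE]].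
  by exists t; [exact: adjoin1_mulg1|exact: natural_le_refl].
exists (t * f); first by rewrite fE -adjoin1_injM.
exists f => //; apply: adjoin1_inj_injective.
by rewrite adjoin1_injM -fE.
Qed.

Lemma sinv_prod n (p : 'I_n -> adjoin1 S) :
  sinv (\prod_(i < n) p i) = \prod_(i < n) sinv (p (rev_ord i)).
Proof.
elim: n p => [|n IHn] p.
  by rewrite !big_ord0 sinv_idempotent // /idempotent_elt mulg1.
rewrite big_ord_recr big_ord_recl sinvM IHn; congr (sinv (p _) * _).
  by apply: val_inj; rewrite /= subn1.
apply: eq_bigr => i _; congr (sinv (p _)); apply: val_inj.
by rewrite /= /bump leq0n subSS.
Qed.

(** If the inverted factors are listed in reverse order, so that their product is
the inverse of s, then the permutation giving the inverse of t is the conjugate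
of f by the reversal of indices. *)
Lemma sim1_sinv s t : sim1 s t -> sim1 (sinv s) (sinv t).
Proof.
move=> [n [p [f [n_gt0 sE tE]]]]; pose r := perm (@rev_ord_inj n).
exists n, (fun i => sinv (p (rev_ord i))), (r * f * r); split => //.
  by rewrite adjoin1_injV sE sinv_prod.
rewrite adjoin1_injV tE sinv_prod; apply: eq_bigr => i _.
by rewrite !permM !permE rev_ordK.
Qed.

Lemma sim_sinv s t : sim s t -> sim (sinv s) (sinv t).
Proof.
elim=> [{}s {}t /sim1_sinv st|{}s t1 {}t _ st1 _ t1t]; first exact: t_step.
exact: t_trans st1 t1t.
Qed.

Lemma natural_le_prod n (p q : 'I_n -> adjoin1 S) :
  (forall i, natural_le (p i) (q i)) ->
  natural_le (\prod_(i < n) p i) (\prod_(i < n) q i).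
Proof.
move=> le_pq; apply: (big_ind2 (@natural_le (adjoin1 S))) => //.
- exact: natural_le_refl.
- by move=> *; apply: natural_leM.
Qed.

(** The factors q i are those of t, except that the last one has absorbed the
idempotent e with s = t e. Their product is s, and every rearrangement of it is
below the same rearrangement of t. *)
Lemma sim1_natural_le s t t' :
  natural_le s t -> sim1 t t' ->
  exists s', natural_le s' t' /\ sim1 s s'.
Proof.
move=> [e ee sE] [[|n] [p [f [// _ tE t'E]]]].
pose q i := if i == ord_max then p i * adjoin1_inj e else p i.
have le_qp i : natural_le (q i) (p i).
  rewrite /q; case: eqP => _; last exact: natural_le_refl.
  by exists (adjoin1_inj e); rewrite // /idempotent_elt -adjoin1_injM ee.
have := natural_le_prod (fun i => le_qp (f i)).
rewrite -t'E => /natural_le_adjoin1_inj[s' s'E le_s't'].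
exists s'; split=> //; exists n.+1, q, f; split=> //.
rewrite sE adjoin1_injM tE !big_ord_recr /= /q eqxx mulgA; congr (_ * _ * _).
by apply: eq_bigr => i _; rewrite -val_eqE /= ltn_eqF.
Qed.

Lemma sim_natural_le s t t' :
  natural_le s t -> sim t t' ->
  exists s', natural_le s' t' /\ sim s s'.
Proof.
move=> le_st tt'; elim: tt' s le_st => [{}t {}t' tt'|{}t t1 {}t' _ IH1 _ IH2] s.
  move=> /sim1_natural_le/(_ tt')[s' [le_s't' ss']].
  by exists s'; split=> //; apply: t_step.
move=> /IH1[s1 [/IH2[s' [le_s't' s1s']] ss1]].
by exists s'; split=> //; apply: t_trans ss1 s1s'.
Qed.

End Adjoin1Inverse.

Theorem lemma13 (S : inverseSemigroupType) (s t : S) :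
  [/\ sim1 s t -> sim1 (sinv s) (sinv t),
      sim s t -> sim (sinv s) (sinv t),
      natural_le s t -> forall t' : S, sim1 t t' ->
        exists s' : S, natural_le s' t' /\ sim1 s s'
    & natural_le s t -> forall t' : S, sim t t' ->
        exists s' : S, natural_le s' t' /\ sim s s'].
Proof.
split; [exact: sim1_sinv | exact: sim_sinv | |].
- by move=> le_st t'; apply: sim1_natural_le.
- by move=> le_st t'; apply: sim_natural_le.
Qed.
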